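(* Fix $s\in X$ and suppose there exists $\Lambda\ge1$ such that $$\left(\sum_{w\in W_k}a_s(w)\right)\left(\sum_{w\in W_k}\frac1{a_s(w)}\right)\le\Lambda m^{2k}$$ for every $k\ge0$ with $\sum_{w\in W_k}a_s(w)>0$ (where $1/0=+\infty$). Then for every $N\ge1$, $$\sum_{k=0}^{N-1}\frac{m^k}{u_{2k+1}(s)-u_{2k}(s)}\le R_N(s)\le\Lambda\sum_{k=0}^{N-1}\frac{m^k}{u_{2k+1}(s)-u_{2k}(s)},$$ where a term with zero denominator is $+\infty$. Equivalently, $$\frac1\Lambda\left(\sum_{k=0}^{N-1}\frac{m^k}{u_{2k+1}(s)-u_{2k}(s)}\right)^{-1}\le\mathrm{Cap}_N(s)\le\left(\sum_{k=0}^{N-1}\frac{m^k}{u_{2k+1}(s)-u_{2k}(s)}\right)^{-1}.$$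
   Context: Let $X$ be a set, $m\ge1$ an integer, and $\varphi_1,\dots,\varphi_m:X\to X$ maps. A kernel $J:X\times X\to\mathbb{C}$ is positive definite if $\sum_{\alpha,\beta}\overline{c_\alpha}c_\beta J(s_\alpha,s_\beta)\ge0$ for all finite families $(c_\alpha,s_\alpha)\in\mathbb{C}\times X$; $J_1\le J_2$ means that $J_2-J_1$ is positive definite. The pullback operator is $(LJ)(s,t):=\sum_{i=1}^m J(\varphi_i(s),\varphi_i(t))$. Fix a positive definite kernel $K$ on $X$ with $LK\ge K$. Set $K_0:=K$, $K_{n+1}:=LK_n$ for $n\ge0$, and $u_n(s):=K_n(s,s)$; one has $K_{n+1}\ge K_n$ and $u_{n+1}(s)\ge u_n(s)$. Words: $W_n:=\{1,\dots,m\}^n$, $W_0=\{\emptyset\}$, $W_*:=\bigcup_{n\ge0}W_n$; for $w=i_1\cdots i_n\in W_n$, $|w|=n$ and $\varphi_w:=\varphi_{i_n}\circ\cdots\circ\varphi_{i_1}$ (with $\varphi_\emptyset=\mathrm{id}$). Network at $s\in X$: consider the rooted $m$-ary tree with vertex set $W_*$, root $\emptyset$, and edges $(w,wi)$, $w\in W_*$, $i\in\{1,\dots,m\}$. Put $a_s(w):=u_{|w|+1}(\varphi_w(s))-u_{|w|}(\varphi_w(s))\ge0$ and give the edge $e=(w,wi)$ the conductance $c_s(e):=a_s(w)/m^{|w|+1}$. A unit flow to depth $N\ge1$ is a nonnegative function $\theta$ on the edges $(w,wi)$ with $|w|\le N-1$ such that $\sum_{i=1}^m\theta(\emptyset,i)=1$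 and, for every vertex $w$ with $0<|w|<N$, $\theta(w^-,w)=\sum_{i=1}^m\theta(w,wi)$, where $w^-$ is the parent of $w$. Its energy is $\mathcal{E}_s(\theta):=\sum_e\theta(e)^2/c_s(e)\in[0,\infty]$, summed over all edges up to depth $N$; when $c_s(e)=0$ the term is $+\infty$ if $\theta(e)>0$ and $0$ if $\theta(e)=0$. Define $R_N(s):=\inf\{\mathcal{E}_s(\theta):\theta\text{ a unit flow to depth }N\}$ and $\mathrm{Cap}_N(s):=1/R_N(s)$, with $1/\infty=0$. *)

(* Defs.v *)
From HB Require Import structures.
From mathcomp Require Import all_boot all_order all_algebra.
From mathcomp Require Import complex.
From mathcomp Require Import all_classical all_reals all_analysis.

Set Implicit Arguments.
Unset Strict Implicit.
Unset Printing Implicit Defensive.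

Import Order.TTheory GRing.Theory Num.Theory.
Local Open Scope ring_scope.

Section Kernels.
Context {R : realType} {X : Type}.

(* In the partial order of R[i], [0 <= z] says that z is real and
   nonnegative. *)
Definition positive_definite (J : X -> X -> R[i]) : Prop :=
  forall (n : nat) (c : 'I_n -> R[i]) (x : 'I_n -> X),
    0 <= \sum_(p < n) \sum_(q < n) (c p)^*%C * c q * J (x p) (x q).

Definition kernel_le (J1 J2 : X -> X -> R[i]) : Prop :=
  positive_definite (fun s t => J2 s t - J1 s t).

Context {m : nat} (phi : 'I_m -> X -> X).

Definition pullback (J : X -> X -> R[i]) : X -> X -> R[i] :=
  fun s t => \sum_(i < m) J (phi i s) (phi i t).

Definition kernel_iter (K : X -> X -> R[i]) (n : nat) : X -> X -> R[i] :=
  iter n pullback K.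

(* The diagonal of a positive definite kernel is real, so taking the real
   part only changes the type. *)
Definition diag_iter (K : X -> X -> R[i]) (n : nat) (s : X) : R :=
  complex.Re (kernel_iter K n s s).

(* The first letter of the word is applied first:
   phi_(i_1 ... i_n) = phi_(i_n) \o ... \o phi_(i_1). *)
Definition word_map (w : seq 'I_m) (s : X) : X :=
  foldl (fun x i => phi i x) s w.

Definition increment (K : X -> X -> R[i]) (s : X) (w : seq 'I_m) : R :=
  diag_iter K (size w).+1 (word_map w s) - diag_iter K (size w) (word_map w s).

End Kernels.

Section Network.
Context {R : realType} {X : Type} {m : nat} (phi : 'I_m -> X -> X).

(* The vertices of the m-ary tree are the words [w : seq 'I_m], and the edge
   (w, wi) is represented by the pair [w, i]. *)
Definition conductance (K : X -> X -> R[i]) (s : X)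
    (w : seq 'I_m) (i : 'I_m) : R :=
  increment phi K s w / m%:R ^+ (size w).+1.

(* Only the values of [theta] on edges (w, wi) with [size w < N] are
   constrained, and only these enter [flow_energy] at depth N. *)
Definition unit_flow (N : nat) (theta : seq 'I_m -> 'I_m -> R) : Prop :=
  [/\ forall w i, (size w < N)%N -> 0 <= theta w i,
      \sum_(i < m) theta [::] i = 1
    & forall w j, (size (rcons w j) < N)%N ->
        theta w j = \sum_(i < m) theta (rcons w j) i].

Local Open Scope ereal_scope.

(* In \bar R, 0^-1 = +oo and 0 * +oo = 0, so the term of an edge of zero
   conductance is +oo when theta is positive there and 0 when theta vanishes. *)
Definition flow_energy (K : X -> X -> R[i]) (s : X) (N : nat)
    (theta : seq 'I_m -> 'I_m -> R) : \bar R :=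
  \sum_(k < N) \sum_(w : k.-tuple 'I_m) \sum_(i < m)
    ((theta w i ^+ 2)%R)%:E / (conductance K s w i)%:E.

Definition resistance (K : X -> X -> R[i]) (s : X) (N : nat) : \bar R :=
  ereal_inf [set flow_energy K s N theta | theta in unit_flow N].

Definition capacity (K : X -> X -> R[i]) (s : X) (N : nat) : \bar R :=
  (resistance K s N)^-1.

(* A summand with zero denominator is +oo, since 0^-1 = +oo and 0 < m ^+ k. *)
Definition level_sum (K : X -> X -> R[i]) (s : X) (N : nat) : \bar R :=
  \sum_(k < N) ((m%:R ^+ k)%R)%:E /
    (diag_iter phi K (2 * k).+1 s - diag_iter phi K (2 * k) s)%R%:E.

End Network.

(* Main.v *)
Require Import Defs.
From HB Require Import structures.
From mathcomp Require Import all_boot all_order all_algebra.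
From mathcomp Require Import complex ring.
From mathcomp Require Import all_classical all_reals all_analysis.

Set Implicit Arguments.
Unset Strict Implicit.
Unset Printing Implicit Defensive.

Import Order.TTheory GRing.Theory Num.Theory.
Local Open Scope ring_scope.

(** The increments of level k add up to
    A_k = u_{2k+1}(s) - u_{2k}(s), because summing over the words of length k
    amounts to k further pullbacks ([sum_increment]).  Hence the edges between
    levels k and k + 1 have total conductance A_k / m^k ([sum_conductance]), and
    m^k / A_k is the resistance of that level when all vertices of the same
    level are glued together.

    Lower bound: a unit flow carries mass 1 through every level, so by
    Cauchy-Schwarz the energy it spends there is at least m^k / A_k
    ([level_sum_le_energy]).  Conductances may vanish; [sqr_sum_div_le] is
    therefore an inequality in the extended reals, obtained from tangent lines so
    that zero weights, with 0^-1 = +oo and 0 * +oo = 0, are covered.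

    Upper bound: the uniform flow, which splits equally at every vertex, spends
    m^-k * sum_w 1 / increment(w) at level k, and the balance hypothesis says
    that this is at most Lambda m^k / A_k ([energy_uniform_flow_le]).

    The bounds on the capacity are the inverses of those on the resistance. *)

(** * Sums over words *)

Lemma sum_words_cons (V : nmodType) (T : finType) k (F : seq T -> V) :
  \sum_(w : k.+1.-tuple T) F w = \sum_i \sum_(w : k.-tuple T) F (i :: w).
Proof.
rewrite pair_bigA (reindex (fun p : T * k.-tuple T => [tuple of p.1 :: p.2])) //=.
exists (fun w : k.+1.-tuple T => (thead w, [tuple of behead w])) => [[i w]|w] _ /=.
  by rewrite theadE; congr pair; apply: val_inj.
by rewrite -tuple_eta.
Qed.

Lemma sum_words0 (V : nmodType) (T : finType) (F : seq T -> V) :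
  \sum_(w : 0.-tuple T) F w = F [::].
Proof. by rewrite (big_pred1 [tuple]) // => w; apply/esym/eqP; exact: tuple0. Qed.

(** Words are prefixed when kernels are pulled back, but extended on the right
    along the edges of the tree; this form serves the node law of flows. *)
Lemma sum_words_rcons (V : nmodType) (T : finType) k (F : seq T -> V) :
  \sum_(w : k.+1.-tuple T) F w = \sum_(w : k.-tuple T) \sum_i F (rcons w i).
Proof.
elim: k F => [|k IHk] F.
  rewrite sum_words_cons (sum_words0 (fun w => \sum_i F (rcons w i))).
  by apply: eq_bigr => i _; rewrite (sum_words0 (fun w => F (i :: w))).
rewrite sum_words_cons (sum_words_cons _ (fun w => \sum_j F (rcons w j))).
by apply: eq_bigr => i _; rewrite (IHk (fun w => F (i :: w))).
Qed.

(** * Increments along the tree *)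

Section Increments.
Context {R : realType} {X : Type} {m : nat} (phi : 'I_m -> X -> X).
Implicit Types (J K : X -> X -> R[i]) (s t : X).

(** The first letter of a word is applied first by [word_map], so unfolding the
    outermost pullback peels off the head of the word. *)
Lemma iter_pullbackE J k s t :
  iter k (pullback phi) J s t =
  \sum_(w : k.-tuple 'I_m) J (word_map phi w s) (word_map phi w t).
Proof.
elim: k s t => [|k IHk] s t.
  by rewrite (sum_words0 (fun w => J (word_map phi w s) (word_map phi w t))).
rewrite (sum_words_cons _ (fun w => J (word_map phi w s) (word_map phi w t))) /=.
by apply: eq_bigr => i _; rewrite IHk.
Qed.

Lemma diag_iterD K k n s :
  diag_iter phi K (k + n) s =
  \sum_(w : k.-tuple 'I_m) diag_iter phi K n (word_map phi w s).
Proof. by rewrite /diag_iter /kernel_iter iterD iter_pullbackE raddf_sum. Qed.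

Lemma kernel_le_diag J1 J2 s : kernel_le J1 J2 ->
  complex.Re (J1 s s) <= complex.Re (J2 s s).
Proof.
move=> /(_ 1 (fun=> 1) (fun=> s)).
rewrite !big_ord1 conjc1 !mul1r subr_ge0.
by case: (J1 s s) (J2 s s) => [a b] [c d]; rewrite lecE /= => /andP[].
Qed.

(** Both values are sums over the words v of length |w|, of the diagonals of
    [pullback phi K] and of K at the same points, so the hypothesis applies
    term by term. *)
Lemma increment_ge0 K s w : kernel_le K (pullback phi K) ->
  0 <= increment phi K s w.
Proof.
move=> hLK; rewrite /increment subr_ge0.
rewrite -[X in diag_iter _ _ X _ <= _]addn0 -[X in _ <= diag_iter _ _ X _]addn1.
by rewrite !diag_iterD; apply: ler_sum => v _; apply: kernel_le_diag hLK.
Qed.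

(** The k letters of w in the base point and the k pullbacks inside each
    increment add up: this is why the levels 2k and 2k + 1 appear. *)
Lemma sum_increment K s k :
  \sum_(w : k.-tuple 'I_m) increment phi K s w =
  diag_iter phi K (2 * k).+1 s - diag_iter phi K (2 * k) s.
Proof.
rewrite mul2n -addnn -addnS !diag_iterD -sumrB.
by apply: eq_bigr => w _; rewrite /increment size_tuple.
Qed.

End Increments.

(** * Cauchy-Schwarz for sums of x^2 / c in the extended reals *)

Section Sedrakyan.
Context {R : realType}.
Local Open Scope ereal_scope.

Lemma ediv_scale (a b c : R) : (0 < c)%R ->
  a%:E / (b / c)%:E = (a * c)%:E / b%:E.
Proof.
move=> c_gt0; rewrite !inver mulf_eq0 invr_eq0 (gt_eqF c_gt0) orbF.
case: eqVneq => [_|b0].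
  by rewrite EFinM -muleA [c%:E * _]gt0_muley ?lte_fin.
by rewrite -!EFinM invfM invrK; congr EFin; ring.
Qed.

(** This is (x - t c)^2 >= 0 divided by c.  The left side is linear in (x, c), so
    these bounds add up over a family; and they make sense for c = 0 too. *)
Lemma sqr_div_ge_tangent (t x c : R) : (0 <= c)%R ->
  (2 * t * x - t ^+ 2 * c)%:E <= (x ^+ 2)%:E / c%:E.
Proof.
rewrite le_eqVlt => /predU1P[<-|c_gt0].
  rewrite inve0; have [->|x0] := eqVneq x 0%R.
    by rewrite !mulr0 subrr expr0n mul0e.
  by rewrite gt0_muley ?leey// lte_fin exprn_even_gt0.
rewrite inver gt_eqF// -EFinM lee_fin ler_pdivlMr// -subr_ge0.
have -> : (x ^+ 2 - (2 * t * x - t ^+ 2 * c) * c = (x - t * c) ^+ 2)%R by ring.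
exact: sqr_ge0.
Qed.

(** For every t the tangent bounds sum to 2 t S - t^2 C, where S and C are the
    sums of x and c.  The best slope gives S^2 / C when C > 0, and letting t
    grow forces the right side to be infinite when C = 0 and S != 0. *)
Lemma sqr_sum_div_le (I : finType) (x c : I -> R) : (forall i, 0 <= c i)%R ->
  ((\sum_i x i) ^+ 2)%:E / (\sum_i c i)%:E <= \sum_i (x i ^+ 2)%:E / (c i)%:E.
Proof.
move=> c_ge0; set S := (\sum_i x i)%R; set C := (\sum_i c i)%R.
set E := (leRHS).
have tangent t : (2 * t * S - t ^+ 2 * C)%:E <= E.
  rewrite /S /C !mulr_sumr -sumrB -sumEFin.
  by apply: lee_sum => i _; apply: sqr_div_ge_tangent.
have C_ge0 : (0 <= C)%R by apply: sumr_ge0.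
have [C0|C_neq0] := eqVneq C 0%R; last first.
  rewrite inver (negPf C_neq0) -EFinM.
  apply: le_trans (tangent (S / C)%R); rewrite lee_fin.
  by rewrite le_eqVlt; apply/orP; left; apply/eqP; field.
have [->|S_neq0] := eqVneq S 0%R.
  by rewrite expr0n mul0e; have := tangent 0%R; rewrite !(mulr0, mul0r) expr0n mul0r subrr.
suff -> : E = +oo by rewrite leey.
apply/eqyP => A A_gt0.
(* With C = 0 the bound is 2 t S, which this slope makes equal to A. *)
apply: le_trans (tangent (A / (2 * S))%R); rewrite C0 lee_fin mulr0 subr0.
by rewrite le_eqVlt; apply/orP; left; apply/eqP; field.
Qed.

End Sedrakyan.

(** * Flows *)

Section Flows.
Context {R : realType} {X : Type} {m : nat}.
Implicit Types (theta : seq 'I_m -> 'I_m -> R).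

(** The node law carries the total mass of one level over to the next. *)
Lemma unit_flow_level N theta k : unit_flow N theta -> (k < N)%N ->
  \sum_(w : k.-tuple 'I_m) \sum_i theta w i = 1.
Proof.
move=> [_ root_flow node_law].
elim: k => [_|k IHk lt_kN].
  by rewrite (sum_words0 (fun w => \sum_i theta w i)).
rewrite -(IHk (ltnW lt_kN)) (sum_words_rcons _ (fun w => \sum_i theta w i)).
apply: eq_bigr => w _; apply: eq_bigr => j _.
by rewrite -node_law // size_rcons size_tuple.
Qed.

Definition uniform_flow (w : seq 'I_m) (i : 'I_m) : R := (m%:R ^+ (size w).+1)^-1.

Lemma uniform_flowP N : (0 < m)%N -> unit_flow N uniform_flow.
Proof.
move=> m_gt0; have m_neq0 : m%:R != 0 :> R by rewrite pnatr_eq0 -lt0n.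
split=> [w i _||w j _]; first by rewrite invr_ge0 exprn_ge0.
  by rewrite sumr_const card_ord /uniform_flow /= expr1 -[LHS]mulr_natr mulVf.
rewrite sumr_const card_ord /uniform_flow size_rcons -[RHS]mulr_natr.
by rewrite [in RHS]exprSr invfM -mulrA mulVf ?mulr1.
Qed.

Context (phi : 'I_m -> X -> X) (K : X -> X -> R[i]).
Hypotheses (m_gt0 : (0 < m)%N) (hLK : kernel_le K (pullback phi K)).
Local Open Scope ereal_scope.

Let increment_ge0 s w : (0 <= increment phi K s w)%R.
Proof. exact: increment_ge0. Qed.

Let mX_gt0 k : (0 < m%:R ^+ k :> R)%R.
Proof. by rewrite exprn_gt0// ltr0n. Qed.

Lemma conductance_ge0 s w i : (0 <= conductance phi K s w i)%R.
Proof. by rewrite divr_ge0// ltW. Qed.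

(** Each vertex w has m children, all joined to it by the conductance
    increment(w) / m^(k+1). *)
Lemma sum_conductance s k :
  (\sum_(w : k.-tuple 'I_m) \sum_i conductance phi K s w i =
  (diag_iter phi K (2 * k).+1 s - diag_iter phi K (2 * k) s) / m%:R ^+ k)%R.
Proof.
rewrite -sum_increment mulr_suml; apply: eq_bigr => w _.
rewrite sumr_const card_ord /conductance size_tuple -[LHS]mulr_natr exprSr invfM.
by rewrite -!mulrA mulVf ?mulr1// pnatr_eq0 -lt0n.
Qed.

(** A unit flow carries total mass 1 across each level, so Cauchy-Schwarz bounds
    the energy of level k below by the inverse of its total conductance. *)
Lemma level_sum_le_energy s N theta : unit_flow N theta ->
  level_sum phi K s N <= flow_energy phi K s N theta.
Proof.
move=> theta_flow; apply: lee_sum => k _.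
rewrite pair_bigA /=.
apply: le_trans (sqr_sum_div_le _ _); last by move=> p; apply: conductance_ge0.
rewrite -(pair_bigA _ (fun w i => theta (tval w) i)).
rewrite -(pair_bigA _ (fun w i => conductance phi K s (tval w) i)) /=.
rewrite (unit_flow_level theta_flow)// sum_conductance expr1n.
by rewrite ediv_scale// mul1r.
Qed.

Lemma uniform_flow_energy s N :
  flow_energy phi K s N uniform_flow =
  \sum_(k < N) (m%:R ^- k)%:E *
    \sum_(w : k.-tuple 'I_m) ((increment phi K s w)%:E)^-1.
Proof.
apply: eq_bigr => k _; rewrite ge0_sume_distrr; last first.
  by move=> w _; rewrite inve_ge0 lee_fin.
apply: eq_bigr => w _.
rewrite /uniform_flow /conductance size_tuple.
transitivity (\sum_(i < m) (m%:R ^- k.+1)%:E * (increment phi K s w)%:E^-1).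
  apply: eq_bigr => i _; rewrite ediv_scale//; congr (_%:E * _).
  by rewrite expr2 -mulrA mulVf ?mulr1// gt_eqF.
rewrite -ge0_sume_distrl; last by move=> i _; rewrite lee_fin invr_ge0 ltW.
rewrite sumEFin sumr_const card_ord -[X in X%:E * _]mulr_natr exprSr invfM -mulrA mulVf ?mulr1//.
by rewrite pnatr_eq0 -lt0n.
Qed.

(** The balance hypothesis bounds the sum of the inverse increments of level k
    by Lambda m^(2k) / A, where A is the sum of the increments; the factor m^-k
    of the uniform flow turns this into Lambda m^k / A.  When A = 0 the right
    side is infinite. *)
Lemma energy_uniform_flow_le s N (Lambda : R) : (0 < Lambda)%R ->
  (forall k : nat,
     (0 < \sum_(w : k.-tuple 'I_m) increment phi K s w)%R ->
     (\sum_(w : k.-tuple 'I_m) increment phi K s w)%:E *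
       (\sum_(w : k.-tuple 'I_m) ((increment phi K s w)%:E)^-1)
      <= (Lambda * m%:R ^+ (2 * k))%:E) ->
  flow_energy phi K s N uniform_flow <= Lambda%:E * level_sum phi K s N.
Proof.
move=> Lambda_gt0 balanced; rewrite uniform_flow_energy ge0_sume_distrr; last first.
  move=> k _; apply: mule_ge0; first by rewrite lee_fin ltW.
  by rewrite inve_ge0 lee_fin -sum_increment sumr_ge0.
apply: lee_sum => k _; rewrite -sum_increment.
have := balanced k.
set A := (\sum_(w : k.-tuple 'I_m) increment phi K s w)%R => balanced_k.
have : (0 <= A)%R by apply: sumr_ge0.
rewrite le_eqVlt => /predU1P[<-|A_gt0].
  by rewrite inve0 !gt0_muley ?leey ?lte_fin.
have := balanced_k A_gt0; rewrite -lee_pdivlMl// => bound.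
rewrite lee_pdivrMl//; apply: le_trans bound _.
rewrite [in leRHS]inver gt_eqF// -!EFinM lee_fin.
rewrite le_eqVlt; apply/orP; left; apply/eqP; rewrite mul2n -addnn exprD; ring.
Qed.

Lemma level_sum_ge0 s N : 0 <= level_sum phi K s N.
Proof.
apply: sume_ge0 => k _; apply: mule_ge0; first by rewrite lee_fin ltW.
by rewrite inve_ge0 lee_fin -sum_increment sumr_ge0.
Qed.

End Flows.

Theorem theorem2p12 (R : realType) (X : Type) (m : nat) (hm : (1 <= m)%N)
  (phi : 'I_m -> X -> X) (K : X -> X -> R[i])
  (hK : positive_definite K) (hLK : kernel_le K (pullback phi K))
  (s : X) (Lambda : R) (hLambda : 1 <= Lambda)
  (hbal : forall k : nat,
     0 < \sum_(w : k.-tuple 'I_m) increment phi K s w ->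
     ((\sum_(w : k.-tuple 'I_m) increment phi K s w)%:E *
       (\sum_(w : k.-tuple 'I_m) ((increment phi K s w)%:E)^-1)
      <= (Lambda * m%:R ^+ (2 * k))%:E)%E)
  (N : nat) (hN : (1 <= N)%N) :
  ((level_sum phi K s N <= resistance phi K s N)%E /\
   (resistance phi K s N <= Lambda%:E * level_sum phi K s N)%E) /\
  (((Lambda^-1)%:E * (level_sum phi K s N)^-1 <= capacity phi K s N)%E /\
   (capacity phi K s N <= (level_sum phi K s N)^-1)%E).
Proof.
have Lambda_gt0 : 0 < Lambda by apply: lt_le_trans hLambda.
have S_ge0 := level_sum_ge0 hm hLK s N.
have lower : (level_sum phi K s N <= resistance phi K s N)%E.
  by apply/ereal_infP => _ [theta theta_flow <-]; apply: level_sum_le_energy.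
have upper : (resistance phi K s N <= Lambda%:E * level_sum phi K s N)%E.
  apply: ge_ereal_inf; exists (flow_energy phi K s N uniform_flow).
    by exists uniform_flow => //; apply: uniform_flowP.
  exact: energy_uniform_flow_le hbal.
have R_ge0 := le_trans S_ge0 lower.
split; [by []|split]; last by rewrite /capacity lee_pV2.
have -> : ((Lambda^-1)%:E * (level_sum phi K s N)^-1 =
          (Lambda%:E * level_sum phi K s N)^-1)%E.
  rewrite inveM ?inver ?gt_eqF// inveM_defE !eqe gt_eqF//=.
  by rewrite lee_fin (lte_fin 0) Lambda_gt0 ltW ?ltry ?implybT.
by rewrite /capacity lee_pV2// inE mule_ge0// lee_fin ltW.
Qed.
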